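(* Let $d\ge 1$ be an integer and let $n\ge 1$. Consider the base-$2d$ representation of $n$, with the least significant digit written first. Let $e$ stand for an even digit and $o$ for an odd digit. (1) If $n = e\cdots$ (the least significant digit of $n$ is even), then $SG_{1,2d}(n)\neq 0$. (2) If $n = o\,e^k\,o\cdots$ for some $k\ge 0$ (the least significant digit is odd, it is followed by exactly $k$ even digits, and these are followed by an odd digit, so that $k$ is maximal), then $SG_{1,2d}(n)=0$ if $k$ is even, and $SG_{1,2d}(n)\ne 0$ if $k$ is odd.
   Context: For a finite set $X$ of non-negative integers, $\mathrm{mex}(X)$ denotes the smallest non-negative integer not in $X$. For an integer $b\ge 2$, $SG_{1,b}$ is the Sprague--Grundy function of the game in which players alternately replace the current total $m$ either by $m-1$ or by $\lceil m/b\rceil$, with total $1$ terminal. That is, $SG_{1,b}(1)=0$ and, for $n\ge 2$, $SG_{1,b}(n)=\mathrm{mex}\{SG_{1,b}(n-1),\,SG_{1,b}(\lceil n/b\rceil)\}$. Here $b=2d$. *)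

(* Defs.v *)
From mathcomp Require Import all_boot.
Set Implicit Arguments.
Unset Strict Implicit.
Unset Printing Implicit Defensive.

Lemma mex_subproof (X : seq nat) : exists n, n \notin X.
Proof.
exists (\max_(x <- X) x).+1; apply/negP => Xm.
by have := @leq_bigmax_seq nat X predT id _ Xm isT; rewrite ltnn.
Qed.

Definition mex (X : seq nat) : nat := ex_minn (mex_subproof X).

Lemma mexP (X : seq nat) :
  mex X \notin X /\ (forall m, m < mex X -> m \in X).
Proof.
rewrite /mex; case: ex_minnP => n Xn min_n; split=> // m lt_mn.
by apply: contraLR lt_mn => Xm; rewrite -leqNgt min_n.
Qed.

Definition ceil_div (m b : nat) : nat := (m + b.-1) %/ b.

Lemma ceil_divP (m b q : nat) : 0 < b -> (ceil_div m b <= q) = (m <= q * b).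
Proof.
by case: b => // b _; rewrite /ceil_div -ltnS ltn_divLR // mulSn /= addnC -addSn leq_add2l.
Qed.

(* Only totals m >= 1 are positions of the game; m = 0 is a junk value. *)
Definition options (b m : nat) : seq nat :=
  if m <= 1 then [::] else [:: m.-1; ceil_div m b].

(* The fuel k makes the recursion structural; for b >= 2 every option of m is
   less than m, so fuel m suffices (see SG1 and SGE). *)
Fixpoint SG_rec (b k m : nat) : nat :=
  if k is k'.+1 then mex [seq SG_rec b k' m' | m' <- options b m] else 0.

(* SG b is the function SG_{1,b}. *)
Definition SG (b n : nat) : nat := SG_rec b n n.

Lemma ltn_ceil_div (b m : nat) : 1 < b -> 1 < m -> ceil_div m b < m.
Proof.
case: m => // m b1 m1; rewrite ltnS ceil_divP ?(ltnW b1) //.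
apply: leq_trans (leq_mul (leqnn m) b1).
by rewrite muln2 -addnn -addn1 leq_add2l.
Qed.

Lemma SG_rec_fuel (b k m : nat) : 1 < b -> m <= k -> SG_rec b k m = SG b m.
Proof.
move=> b1; rewrite /SG; elim/ltn_ind: m k => -[|m] IHm [|k] //=.
  by move=> _; rewrite /mex; case: ex_minnP => -[|n] // _ /(_ 0 isT).
rewrite ltnS => le_mk; congr mex; rewrite /options ltnS.
case: (posnP m) => [-> //|m0]; rewrite leqNgt m0 /=.
have lt_c: ceil_div m.+1 b <= m by rewrite -ltnS ltn_ceil_div.
by rewrite !(IHm (ceil_div m.+1 b)) ?(IHm m) ?(leq_trans lt_c) // ltnS.
Qed.

Lemma SG1 (b : nat) : SG b 1 = 0.
Proof. by rewrite /SG /= /mex; case: ex_minnP => -[|n] // _ /(_ 0 isT). Qed.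

Lemma SGE (b n : nat) : 1 < b -> 1 < n ->
  SG b n = mex [:: SG b n.-1; SG b (ceil_div n b)].
Proof.
case: n => // n b1 n1; rewrite {1}/SG /= /options leqNgt n1 /=.
have lt_c: ceil_div n.+1 b <= n by rewrite -ltnS ltn_ceil_div.
by rewrite !SG_rec_fuel.
Qed.

(* Least significant digit first. The representation is meant for b >= 2 and
   n >= 1, and then has no superfluous zero at the end. *)
Definition digits (b n : nat) : seq nat :=
  mkseq (fun i => (n %/ b ^ i) %% b) (trunc_log b n).+1.

Lemma digits_lt (b n : nat) : 0 < b -> all (fun x => x < b) (digits b n).
Proof. by move=> b0; apply/allP => x /mapP[i _ ->]; rewrite ltn_mod. Qed.

Lemma last_digits (b n : nat) : 1 < b -> 0 < n -> last 0 (digits b n) != 0.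
Proof.
move=> b1 n0; have /andP[le_n lt_n] := trunc_log_bounds b1 n0.
rewrite -nth_last size_mkseq nth_mkseq //=.
rewrite modn_small; last by rewrite ltn_divLR ?expn_gt0 ?(ltnW b1) // -expnS.
by rewrite -lt0n divn_gt0 ?expn_gt0 ?(ltnW b1).
Qed.

Lemma digits_sum (b n : nat) : 1 < b -> 0 < n ->
  \sum_(i < size (digits b n)) nth 0 (digits b n) i * b ^ i = n.
Proof.
move=> b1 n0; rewrite size_mkseq.
under eq_bigr => i _ do rewrite nth_mkseq //.
have -> : forall k, \sum_(i < k) (n %/ b ^ i) %% b * b ^ i = n %% b ^ k.
  elim=> [|k IHk]; first by rewrite big_ord0 modn1.
  have bk0: 0 < b ^ k by rewrite expn_gt0 (ltnW b1).
  rewrite big_ord_recr /= IHk expnSr addnC.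
  set q := n %/ b ^ k; set r := n %% b ^ k.
  have -> : n = q %/ b * (b ^ k * b) + (q %% b * b ^ k + r).
    by rewrite addnA [b ^ k * b]mulnC mulnA -mulnDl -divn_eq -divn_eq.
  rewrite modnMDl [RHS]modn_small //.
  apply: (@leq_trans ((q %% b).+1 * b ^ k)).
    by rewrite mulSn addnC ltn_add2r ltn_mod.
  by rewrite [leqRHS]mulnC leq_mul2r ltn_mod (ltnW b1) orbT.
by rewrite modn_small // trunc_log_ltn.
Qed.

(* Main.v *)
Require Import Defs.
From mathcomp Require Import all_boot.

(** Write b for the base, which is even, and g for [SG b]. For n > 1, g(n) = 0
iff neither option has value 0. An even n has the same ceiling ceil(n/b) as
n-1, so g(n) = 0 would force g(n-2) = 0, and descent reaches
g(2) <> 0: hence g never vanishes on even numbers. Consequently, for odd n > 1,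
g(n) = 0 iff g(q+1) <> 0 where q = floor(n/b). If q is odd then q+1 is even and
g(n) = 0; if q is even then adding 1 causes no carry, so n = o e^k o...
gives q+1 = o e^(k-1) o... (least significant digit first). *)

Lemma mex_eq0 (X : seq nat) : (mex X == 0) = (0 \notin X).
Proof.
have [mexN mex_lt] := mexP X; apply/idP/idP => [/eqP<- // |].
by rewrite -leqn0 leqNgt; apply: contra => /mex_lt.
Qed.

Lemma SG_eq0 (b n : nat) : 1 < b -> 1 < n ->
  (SG b n == 0) = (SG b n.-1 != 0) && (SG b (ceil_div n b) != 0).
Proof.
by move=> b1 n1; rewrite SGE // mex_eq0 !inE negb_or ![0 == _]eq_sym.
Qed.

Lemma ceil_divS (b n : nat) : 0 < b -> ceil_div n.+1 b = (n %/ b).+1.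
Proof.
by move=> b0; rewrite /ceil_div addSn -addnS prednK // divnDr // divnn b0 addn1.
Qed.

(** An even [b] cannot divide the odd [n.+1], so the quotient does not step up there. *)
Lemma divnS_even (b n : nat) : 0 < b -> ~~ odd b -> ~~ odd n ->
  n.+1 %/ b = n %/ b.
Proof.
move=> b0 be ne; rewrite divnS //; suff /negPf-> : ~~ (b %| n.+1) by [].
by apply: contra be => /dvdn_odd; apply.
Qed.

Lemma SG_even_neq0 (b n : nat) : 1 < b -> ~~ odd b -> 0 < n -> ~~ odd n ->
  SG b n != 0.
Proof.
move=> b1 be; have b0 := ltnW b1.
elim/ltn_ind: n => -[|[|[|n]]] IHn // _ ne; rewrite SG_eq0 //=; first by rewrite SG1.
case: n => [|n] in IHn ne *; first by rewrite /= in ne.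
rewrite SG_eq0 //= IHn //=; last by move: ne; rewrite /= !negbK.
have ne' : ~~ odd n.+2 by move: ne; rewrite /= !negbK.
(* The value at [n.+3] now vanishes iff the value at its ceiling does not; [n.+4] has the same
   ceiling, so its two options cannot both be nonzero. *)
by rewrite !ceil_divS // (@divnS_even _ n.+2) //; case: (_ != 0).
Qed.

Lemma SG_odd_eq0 (b n : nat) : 1 < b -> ~~ odd b -> 1 < n -> odd n ->
  (SG b n == 0) = (SG b (n %/ b).+1 != 0).
Proof.
move=> b1 be; have b0 := ltnW b1; case: n => // n n1 ne.
by rewrite SG_eq0 //= SG_even_neq0 //= ceil_divS // divnS_even.
Qed.

(** Phrased with parities of quotients instead of a digit list, so that the induction on [k] can
    pass from [n] to [(n %/ b).+1]. *)
Lemma SG_odd_evens_odd (b k n : nat) : 1 < b -> ~~ odd b -> odd n ->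
  (forall i, i < k -> ~~ odd (n %/ b ^ i.+1)) -> odd (n %/ b ^ k.+1) ->
  (SG b n == 0) = ~~ odd k.
Proof.
move=> b1 be; have b0 := ltnW b1.
elim: k n => [|k IHk] n no n_even n_odd.
  (* If [n <= 1], then [n] is below the power of [b] in [n_odd], whose quotient would be 0. *)
  all: have n1 : 1 < n by rewrite ltnNge; apply: contraL n_odd => n1;
    rewrite divn_small // (leq_ltn_trans n1) // -(expn0 b) ltn_exp2l.
  by rewrite SG_odd_eq0 // SG_even_neq0 //= -[b]expn1 n_odd.
have qe : ~~ odd (n %/ b) by have := n_even 0 isT; rewrite expn1.
have divq i : (n %/ b).+1 %/ b ^ i.+1 = n %/ b ^ i.+2.
  by rewrite expnS divnMA divnS_even // -!divnMA -!expnS.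
rewrite SG_odd_eq0 // IHk //= => [i lt_ik|]; rewrite divq //.
exact: n_even.
Qed.

Lemma nth_digits (b n i : nat) : 1 < b -> nth 0 (digits b n) i = n %/ b ^ i %% b.
Proof.
move=> b1; have [lt_i|le_i] := ltnP i (trunc_log b n).+1; first exact: nth_mkseq.
(* Past the last digit [n < b ^ i], so the default 0 is the right value. *)
rewrite nth_default ?size_mkseq // divn_small ?mod0n //.
by rewrite (leq_trans (trunc_log_ltn n b1)) // leq_exp2l.
Qed.

(** Reduction modulo an even base preserves parity. *)
Lemma odd_digit (b n i : nat) : 1 < b -> ~~ odd b ->
  odd (nth 0 (digits b n) i) = odd (n %/ b ^ i).
Proof.
move=> b1 /negPf be; rewrite nth_digits // [in RHS](divn_eq (n %/ b ^ i) b).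
by rewrite oddD oddM be andbF.
Qed.

Theorem theorem3 (d n : nat) (hd : 1 <= d) (hn : 1 <= n) :
  (forall (x : nat) (t : seq nat),
     digits (2 * d) n = x :: t -> ~~ odd x -> SG (2 * d) n <> 0)
  /\
  (forall (k x y : nat) (w t : seq nat),
     digits (2 * d) n = x :: w ++ y :: t ->
     odd x -> size w = k -> all (fun z => ~~ odd z) w -> odd y ->
     (~~ odd k -> SG (2 * d) n = 0) /\ (odd k -> SG (2 * d) n <> 0)).
Proof.
have b1 : 1 < 2 * d by rewrite -[2]muln1 leq_mul.
have be : ~~ odd (2 * d) by rewrite oddM.
have oddE i := odd_digit (2 * d) n i b1 be.
split=> [x t digE xe | k x y w t digE xo sz_w we yo].
  by apply/eqP; apply: SG_even_neq0 => //; have := oddE 0; rewrite digE divn1 => <-.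
suff SGn0 : (SG (2 * d) n == 0) = ~~ odd k.
  by split=> kP; [apply/eqP | apply/eqP]; rewrite SGn0 ?kP.
apply: SG_odd_evens_odd => // [|i lt_ik|].
- by have := oddE 0; rewrite digE divn1 => <-.
- rewrite -oddE digE /= nth_cat sz_w lt_ik.
  by apply: (allP we); rewrite mem_nth ?sz_w.
- by rewrite -oddE digE /= nth_cat sz_w ltnn subnn.
Qed.
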